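(* In the free step-two group $N_{3,2}$ described in the context, let $x=|x|e_1$ with $|x|>0$ and let $\theta=(\theta_1,\theta_2,0)\in B_{\mathbb R^3}(0,\pi)$ with $\theta_2>0$. Put $$t=\frac{|x|^2}{4}\theta_2\Big[\frac{\psi'(|\theta|)}{|\theta|}\theta_2\,\theta+2\psi(|\theta|)e_2\Big].$$ Then $$d(x,t)^2=\phi((x,t);\theta)=|x|^2\big[1+\psi(|\theta|)\theta_2^2+\psi'(|\theta|)|\theta|\theta_2^2\big]=|x|^2\Big[\frac{\theta_1^2}{|\theta|^2}+\Big(\frac{\theta_2}{\sin|\theta|}\Big)^2\Big]=\Big|\frac{U(\theta)}{\sin U(\theta)}x\Big|^2.$$
   Context: $N_{3,2}$ is $\mathbb R^3\times\mathbb R^3$ with law $(x,t)\cdot(x',t')=(x+x',t+t'+\frac12\langle\mathbb Ux,x'\rangle)$, $\langle\mathbb Ux,x'\rangle=(\langle U^{(j)}x,x'\rangle)_{j=1}^3$, where $\sum_j\tau_jU^{(j)}=\begin{pmatrix}0&\tau_3&-\tau_2\\-\tau_3&0&\tau_1\\\tau_2&-\tau_1&0\end{pmatrix}$; identity $o$. $d(g)$ is the Carnot–Carathéodory distance from $o$ (infimum of $\int_0^1|x'|$ over absolutely continuous curves from $o$ to $g$ with $t'=\frac12\langle\mathbb Ux,x'\rangle$). $U(\tau)=i\sum_j\tau_jU^{(j)}$; $e_1,e_2,e_3$ standard basis. $\psi(s)=(1-s\cot s)/s^2$ ($\psi(0)=1/3$), and $\phi((x,t);\tau)=\langle U(\tau)\cot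 U(\tau)x,x\rangle+4t\cdot\tau=|x|^2|\tau|\cot|\tau|+\psi(|\tau|)\langle\tau,x\rangle^2+4t\cdot\tau$. *)

(* Defs.v *)
From mathcomp Require Import all_boot all_algebra.
From mathcomp Require Import all_classical all_reals all_analysis.
From mathcomp Require Import complex.
Set Implicit Arguments. Unset Strict Implicit. Unset Printing Implicit Defensive.
Import GRing.Theory Num.Theory.
Local Open Scope ring_scope.

Section N32.
Variable R : realType.

Definition evec (j : 'I_3) : 'rV[R]_3 := \row_(i < 3) (if i == j then 1 else 0).

Definition dot3 (u v : 'rV[R]_3) : R := \sum_(i < 3) u 0 i * v 0 i.
Definition norm3 (u : 'rV[R]_3) : R := Num.sqrt (dot3 u u).

(* sum_j tau_j U^(j) =
   [[0, tau3, -tau2]; [-tau3, 0, tau1]; [tau2, -tau1, 0]] *)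
Definition Umat (tau : 'rV[R]_3) : 'M[R]_3 :=
  \matrix_(a < 3, b < 3)
    (if (a == 0 :> nat) && (b == 1 :> nat) then tau 0 2
     else if (a == 0 :> nat) && (b == 2 :> nat) then - tau 0 1
     else if (a == 1 :> nat) && (b == 0 :> nat) then - tau 0 2
     else if (a == 1 :> nat) && (b == 2 :> nat) then tau 0 0
     else if (a == 2 :> nat) && (b == 0 :> nat) then tau 0 1
     else if (a == 2 :> nat) && (b == 1 :> nat) then - tau 0 0
     else 0).

Definition Uj (j : 'I_3) : 'M[R]_3 := Umat (evec j).

Definition Ubil (j : 'I_3) (x y : 'rV[R]_3) : R :=
  \sum_(a < 3) \sum_(b < 3) Uj j a b * x 0 b * y 0 a.

(* Horizontal curves, parametrized by their (Lebesgue integrable)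
   velocity h = x' on [0,1]: the absolutely continuous curve starting at o
   is x(s) = int_0^s h,  t_j(s) = int_0^s 1/2 <U^(j) x(r), h(r)> dr. *)
Definition hpos (h : R -> 'rV[R]_3) (s : R) : 'rV[R]_3 :=
  \row_(i < 3) (\int[lebesgue_measure]_(r in `[0, s]) h r 0 i).

Definition hvert (h : R -> 'rV[R]_3) (s : R) : 'rV[R]_3 :=
  \row_(j < 3) (\int[lebesgue_measure]_(r in `[0, s])
                   (2^-1 * Ubil j (hpos h r) (h r))).

Definition admissible_control (h : R -> 'rV[R]_3) : Prop :=
  forall i : 'I_3,
    lebesgue_measure.-integrable `[0%R, 1%R] (fun r => (h r 0 i)%:E).

Definition hlength (h : R -> 'rV[R]_3) : R :=
  \int[lebesgue_measure]_(r in `[0%R, 1%R]) norm3 (h r).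

Definition ccdist (x t : 'rV[R]_3) : R :=
  inf [set L | exists h, admissible_control h /\
                hpos h 1 = x /\ hvert h 1 = t /\ L = hlength h].

Definition cot (s : R) : R := cos s / sin s.

Definition psi (s : R) : R :=
  if s == 0 then 3^-1 else (1 - s * cot s) / s ^+ 2.

Definition scot (s : R) : R := if s == 0 then 1 else s * cot s.

Definition phi (x t tau : 'rV[R]_3) : R :=
  norm3 x ^+ 2 * scot (norm3 tau) + psi (norm3 tau) * dot3 tau x ^+ 2
  + 4 * dot3 t tau.

Definition s_over_sin (s : R) : R := if s == 0 then 1 else s / sin s.

Definition Uc (tau : 'rV[R]_3) : 'M[R[i]]_3 :=
  \matrix_(a, b) Complex 0 (Umat tau a b).

Definition cadj (M : 'M[R[i]]_3) : 'M[R[i]]_3 :=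
  \matrix_(a, b) conjc (M b a).

(* Functional calculus for Hermitian matrices: F = f(H) iff
   H = Q diag(lam) Q^* with Q unitary, lam real, and F = Q diag(f(lam)) Q^*. *)
Definition herm_fun (f : R -> R) (H F : 'M[R[i]]_3) : Prop :=
  exists (Q : 'M[R[i]]_3) (lam : 'rV[R]_3),
    Q *m cadj Q = 1%:M /\
    H = Q *m diag_mx (\row_i Complex (lam 0 i) 0) *m cadj Q /\
    F = Q *m diag_mx (\row_i Complex (f (lam 0 i)) 0) *m cadj Q.

Definition ccol (x : 'rV[R]_3) : 'cV[R[i]]_3 := \col_i Complex (x 0 i) 0.

Definition cnorm2 (v : 'cV[R[i]]_3) : R :=
  \sum_(i < 3) (complex.Re (v i 0) ^+ 2 + complex.Im (v i 0) ^+ 2).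

End N32.

Arguments evec {R} j.
Arguments Uj {R} j.
Arguments psi {R} s.
Arguments s_over_sin {R} s.
Arguments scot {R} s.

(* Main.v *)
Require Import Defs.
From mathcomp Require Import all_boot all_order all_algebra.
From mathcomp Require Import all_classical all_reals all_analysis.
From mathcomp Require Import measurable_realfun complex.
From mathcomp Require Import ring lra.
Set Implicit Arguments.
Unset Strict Implicit.
Unset Printing Implicit Defensive.
Import Order.TTheory GRing.Theory Num.Theory.
Import numFieldNormedType.Exports.
Local Open Scope classical_set_scope.
Local Open Scope ring_scope.

(** The lower bound is a calibration argument, valid for every [tau] with
    [0 < |tau| < pi].  Put [w = |tau|], [n = tau / w]; for a horizontal curve [(y, T)]
    of length [L] with arc length [l(r)], and [e > 0], [K = w / (L + e)], the function
      [K cot (K (l + e)) (|y|^2 - <y, n>^2) + <y, n>^2 / (l + e) + 4 K <T, n> - l]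
    vanishes at [0] and is nonincreasing, because its derivative times [l'] is minus a
    squared norm.
    At the endpoint this reads [phi (y, T) tau <= L (L + e)]; let [e] tend to [0].
    The shift by [e] removes the singularity of the cotangent at the origin.
    Differentiation needs continuous controls; integrable ones follow since position,
    area and length are continuous for the [L^1] norm of the control.
    At [tau = theta] the bound is attained by an explicit helix. *)

(** * Coordinate formulas for the inner product and the vertical forms *)

Section Coordinates.
Variable R : realType.
Implicit Types u v x t tau : 'rV[R]_3.

Lemma dot3E u v : dot3 u v = u 0 0 * v 0 0 + u 0 1 * v 0 1 + u 0 2 * v 0 2.
Proof.
rewrite /dot3 !big_ord_recl big_ord0 addr0 addrA.
by congr (_ * _ + _ * _ + _ * _); congr (_ _ _); apply: val_inj.
Qed.

Lemma dot3_ge0 u : 0 <= dot3 u u.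
Proof. by rewrite dot3E !addr_ge0 // -expr2 sqr_ge0. Qed.

Lemma sqr_norm3 u : norm3 u ^+ 2 = dot3 u u.
Proof. by rewrite sqr_sqrtr // dot3_ge0. Qed.

Lemma ord3P (P : 'I_3 -> Prop) : P 0 -> P 1 -> P 2 -> forall i, P i.
Proof.
move=> P0 P1 P2 [[|[|[|//]]] ?].
- by move: P0; congr P; apply: val_inj.
- by move: P1; congr P; apply: val_inj.
- by move: P2; congr P; apply: val_inj.
Qed.

Lemma sum3E (V : nmodType) (F : 'I_3 -> V) : \sum_(i < 3) F i = F 0 + F 1 + F 2.
Proof.
rewrite !big_ord_recl big_ord0 addr0 addrA.
by congr (_ + _ + _); congr F; apply: val_inj.
Qed.

(** The forms [Ubil 0], [Ubil 1], [Ubil 2] are, in this order, the coordinates of the cross product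
    of [y] and [x]; the vertical velocity is therefore half the cross product of velocity and
    position. *)
Lemma Ubil0E x y : Ubil 0 x y = x 0 2 * y 0 1 - x 0 1 * y 0 2.
Proof. by rewrite /Ubil !sum3E /Uj /Umat !mxE /=; ring. Qed.

Lemma Ubil1E x y : Ubil 1 x y = x 0 0 * y 0 2 - x 0 2 * y 0 0.
Proof. by rewrite /Ubil !sum3E /Uj /Umat !mxE /=; ring. Qed.

Lemma Ubil2E x y : Ubil 2 x y = x 0 1 * y 0 0 - x 0 0 * y 0 1.
Proof. by rewrite /Ubil !sum3E /Uj /Umat !mxE /=; ring. Qed.

End Coordinates.

(** * Pointwise derivative rules and the cotangent *)

Section Calculus.
Variable R : realType.
Implicit Types (f g : R -> R) (x a b : R).

(** These rules are phrased for explicit functions [fun y => ...] and with products of reals in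
    place of scaling, so that the derivative of a long expression is obtained by nesting them and
    then corrected by [ring] or [field] through [is_derive_eq]. *)
Lemma is_derive1D f g x a b : is_derive x (1 : R) f a -> is_derive x (1 : R) g b ->
  is_derive x (1 : R) (fun y => f y + g y) (a + b).
Proof. exact: is_deriveD. Qed.

Lemma is_derive1B f g x a b : is_derive x (1 : R) f a -> is_derive x (1 : R) g b ->
  is_derive x (1 : R) (fun y => f y - g y) (a - b).
Proof. exact: is_deriveB. Qed.

Lemma is_derive1M f g x a b : is_derive x (1 : R) f a -> is_derive x (1 : R) g b ->
  is_derive x (1 : R) (fun y => f y * g y) (a * g x + f x * b).
Proof.
move=> df dg; have := is_deriveM df dg => /is_derive_eq; apply.
by rewrite addrC; congr (_ + _); rewrite // /GRing.scale /= mulrC.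
Qed.

Lemma is_derive1V f x a : f x != 0 -> is_derive x (1 : R) f a ->
  is_derive x (1 : R) (fun y => (f y)^-1) (- a / f x ^+ 2).
Proof.
move=> fx0 [df va]; split; first exact: derivableV.
by rewrite deriveV // va /GRing.scale /= mulrC mulNr mulrN.
Qed.

Lemma is_derive1X2 f x a : is_derive x (1 : R) f a ->
  is_derive x (1 : R) (fun y => f y ^+ 2) (2 * f x * a).
Proof.
move=> df; have := is_derive1M df df.
under eq_fun do rewrite -expr2.
by move=> /is_derive_eq; apply; ring.
Qed.

Lemma is_derive1_cot f x a : sin (f x) != 0 -> is_derive x (1 : R) f a ->
  is_derive x (1 : R) (fun y => cot (f y)) (- a / sin (f x) ^+ 2).
Proof.
move=> s0 df; have dc : is_derive x (1 : R) (fun y => cos (f y)) (- sin (f x) * a).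
  exact: is_derive1_comp.
have ds : is_derive x (1 : R) (fun y => sin (f y)) (cos (f x) * a).
  exact: is_derive1_comp.
have := is_derive1M dc (is_derive1V s0 ds) => /is_derive_eq; apply.
transitivity (- a * (cos (f x) ^+ 2 + sin (f x) ^+ 2) / sin (f x) ^+ 2).
  by field.
by rewrite cos2Dsin2 mulr1.
Qed.

(** A general filter is allowed because the calibrating function is studied along the trace of
    neighbourhoods on [[0, 1]], which is one-sided at the endpoints. *)
Lemma continuous_cvg_cot (T : Type) (F : set_system T) (FF : Filter F) (f : T -> R) x :
  sin x != 0 -> f t @[t --> F] --> x -> cot (f t) @[t --> F] --> cot x.
Proof.
move=> s0 fx; apply: cvgM.
  by apply: continuous_cvg => //; exact: continuous_cos.
by apply: cvgV => //; apply: continuous_cvg => //; exact: continuous_sin.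
Qed.

End Calculus.

(** * Integrals with variable upper limit *)

Section Primitive.
Variable R : realType.
Notation mu := (@lebesgue_measure R).
Implicit Types (f g : R -> R) (s b : R).

Definition prim f s : R := \int[mu]_(r in `[0, s]) f r.

Lemma prim0 f : prim f 0 = 0.
Proof. by rewrite /prim set_itv1 Rintegral_set1. Qed.

(** Continuity on the half-line from [0], one-sided at [0]. This class is closed under [prim] and
    the ring operations, and it gives ordinary continuity at every positive point. *)
Definition cont0y f := forall b, {within `[0, b], continuous f}.

Lemma continuous_cont0y f : continuous f -> cont0y f.
Proof. by move=> cf b; apply: continuous_subspaceT. Qed.

Lemma cont0y_integrable f b : cont0y f -> mu.-integrable `[0, b] (EFin \o f).
Proof.
by move=> cf; apply: continuous_compact_integrable => //; exact: segment_compact.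
Qed.

Lemma integrable_prim_cont f b : mu.-integrable `[0, b] (EFin \o f) ->
  {within `[0, b], continuous (prim f)}.
Proof.
have [b0|b0] := leP 0 b; first exact: parameterized_integral_continuous.
by rewrite set_itv_ge ?bnd_simp -?ltNge // => _; exact: continuous_subspace0.
Qed.

Lemma cont0y_prim f : cont0y f -> cont0y (prim f).
Proof. by move=> cf b; exact/integrable_prim_cont/cont0y_integrable. Qed.

Lemma cont0yD f g : cont0y f -> cont0y g -> cont0y (fun s => f s + g s).
Proof. by move=> cf cg b x; apply: cvgD; [exact: cf|exact: cg]. Qed.

Lemma cont0yB f g : cont0y f -> cont0y g -> cont0y (fun s => f s - g s).
Proof. by move=> cf cg b x; apply: cvgB; [exact: cf|exact: cg]. Qed.

Lemma cont0yM f g : cont0y f -> cont0y g -> cont0y (fun s => f s * g s).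
Proof. by move=> cf cg b x; apply: cvgM; [exact: cf|exact: cg]. Qed.

Lemma cont0y_cst (c : R) : cont0y (fun=> c).
Proof. by move=> b x; exact: cvg_cst. Qed.

Lemma cont0y_at f s : 0 < s -> cont0y f -> {for s, continuous f}.
Proof.
move=> s0 cf; have : {within `]0, s + 1[, continuous f}.
  by apply: continuous_subspaceW (cf (s + 1)) => x; exact: subset_itv_oo_cc.
rewrite continuous_open_subspace => [|]; last exact: interval_open.
by apply; rewrite inE /= in_itv /= s0 ltrDl ltr01.
Qed.

Lemma is_derive_prim f s : 0 < s -> cont0y f -> is_derive s (1 : R) (prim f) (f s).
Proof.
move=> s0 cf.
have [d v] : derivable (prim f) s 1 /\ derive1 (prim f) s = f s.
  (* The right end [s + 1] makes [s] an interior point, as a two-sided derivative requires. *)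
  apply: (@continuous_FTC1_closed _ _ 0 s (s + 1)) => //.
  - by rewrite ltrDl.
  - exact: cont0y_integrable.
  - exact: cont0y_at.
split; first exact: d.
by rewrite -derive1E.
Qed.

End Primitive.

(* With [u = lam * (q (y - P n) + K (y x n) + P isg n)], the left-hand side times
   [lam] is [- |u - v|^2]; if [lam] vanishes, then so does [v]. *)
Lemma calibration_le0 (R : realType) (y1 y2 y3 v1 v2 v3 n1 n2 n3 lam q K isg P vn W : R) :
  n1 ^+ 2 + n2 ^+ 2 + n3 ^+ 2 = 1 -> 0 <= lam ->
  lam ^+ 2 = v1 ^+ 2 + v2 ^+ 2 + v3 ^+ 2 ->
  P = y1 * n1 + y2 * n2 + y3 * n3 ->
  vn = v1 * n1 + v2 * n2 + v3 * n3 ->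
  W = y1 ^+ 2 + y2 ^+ 2 + y3 ^+ 2 - P ^+ 2 ->
  - lam * (K ^+ 2 + q ^+ 2) * W
  + q * (2 * (y1 * v1 + y2 * v2 + y3 * v3) - 2 * P * vn)
  + 2 * P * vn * isg - lam * P ^+ 2 * isg ^+ 2
  + 2 * K * ((y3 * v2 - y2 * v3) * n1 + (y1 * v3 - y3 * v1) * n2
             + (y2 * v1 - y1 * v2) * n3) - lam <= 0.
Proof.
move=> n_unit lam0 lamE PE vnE WE; set D := (X in X <= 0).
have [lam_gt0|] := ltP 0 lam; last first.
  move=> lam_le0; have l0 : lam = 0 by apply/eqP; rewrite eq_le lam_le0.
  have : v1 ^+ 2 + v2 ^+ 2 + v3 ^+ 2 = 0 by rewrite -lamE l0 expr0n.
  move/eqP; rewrite !paddr_eq0 ?addr_ge0 ?sqr_ge0 // !sqrf_eq0.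
  move=> /andP[/andP[/eqP v10 /eqP v20] /eqP v30].
  by rewrite le_eqVlt; apply/orP; left; apply/eqP; rewrite /D vnE l0 v10 v20 v30; ring.
pose u1 := lam * (q * (y1 - P * n1) + K * (y2 * n3 - y3 * n2) + P * isg * n1) - v1.
pose u2 := lam * (q * (y2 - P * n2) + K * (y3 * n1 - y1 * n3) + P * isg * n2) - v2.
pose u3 := lam * (q * (y3 - P * n3) + K * (y1 * n2 - y2 * n1) + P * isg * n3) - v3.
suff E : lam * D = - (u1 ^+ 2 + u2 ^+ 2 + u3 ^+ 2).
  by rewrite -(pmulr_rle0 _ lam_gt0) E oppr_le0 !addr_ge0 ?sqr_ge0.
have nE : n3 ^+ 2 = 1 - n1 ^+ 2 - n2 ^+ 2 by rewrite -n_unit; ring.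
have vE : v3 ^+ 2 = lam ^+ 2 - v1 ^+ 2 - v2 ^+ 2 by rewrite lamE; ring.
rewrite /D /u1 /u2 /u3 WE vnE PE.
ring: nE vE.
Qed.

(** * Calibration along curves with continuous velocity *)

Section ContinuousControl.
Variable R : realType.
Notation mu := (@lebesgue_measure R).
Variables (h : R -> 'rV[R]_3).
Hypothesis ch : forall i, continuous (fun s => h s 0 i).
Implicit Types (s : R).

Lemma hposE (g : R -> 'rV[R]_3) s i : hpos g s 0 i = prim (fun r => g r 0 i) s.
Proof. by rewrite mxE. Qed.

Lemma hvertE (g : R -> 'rV[R]_3) s j :
  hvert g s 0 j = prim (fun r => 2^-1 * Ubil j (hpos g r) (g r)) s.
Proof. by rewrite mxE. Qed.

Lemma continuous_norm3 (g : R -> 'rV[R]_3) :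
  (forall i, continuous (fun s => g s 0 i)) -> continuous (fun s => norm3 (g s)).
Proof.
move=> cg s; apply: (@continuous_comp _ _ _ (fun s => dot3 (g s) (g s)) Num.sqrt).
  2: exact: sqrt_continuous.
have -> : (fun r => dot3 (g r) (g r)) =
    fun r => g r 0 0 * g r 0 0 + g r 0 1 * g r 0 1 + g r 0 2 * g r 0 2.
  by apply/funext => r; rewrite dot3E.
by apply: cvgD; [apply: cvgD|]; apply: cvgM; exact: cg.
Qed.

Lemma cont0y_hvert j : cont0y (fun r => 2^-1 * Ubil j (hpos h r) (h r)).
Proof.
apply: cont0yM; first exact: cont0y_cst.
have c i k : cont0y (fun r => hpos h r 0 i * h r 0 k).
  apply: cont0yM; last exact: continuous_cont0y.
  under eq_fun do rewrite hposE.
  exact/cont0y_prim/continuous_cont0y.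
elim/ord3P: j.
- by under eq_fun do rewrite Ubil0E; apply: cont0yB.
- by under eq_fun do rewrite Ubil1E; apply: cont0yB.
- by under eq_fun do rewrite Ubil2E; apply: cont0yB.
Qed.

Let len s := prim (fun r => norm3 (h r)) s.

Let clen : cont0y len.
Proof. exact/cont0y_prim/continuous_cont0y/continuous_norm3. Qed.

Let len_ge0 s : 0 <= len s.
Proof. by apply: Rintegral_ge0 => r _; exact: sqrtr_ge0. Qed.

Let dlen s : 0 < s -> is_derive s (1 : R) len (norm3 (h s)).
Proof.
by move=> s0; apply: is_derive_prim => //; exact/continuous_cont0y/continuous_norm3.
Qed.

Let len_le s : 0 <= s <= 1 -> len s <= len 1.
Proof.
move=> /andP[s0 s1].
apply: (@ger0_derive1_le_cc _ len 0 1); rewrite ?in_itv /= ?s0 ?s1 ?ler01 ?lexx //.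
- by move=> x; rewrite in_itv /= => /andP[x0 _]; have [] := dlen x0.
- move=> x; rewrite in_itv /= => /andP[x0 _]; have [_] := dlen x0.
  by rewrite derive1E => ->; exact: sqrtr_ge0.
Qed.

Lemma calibration_length (n : 'rV[R]_3) (K e : R) :
  dot3 n n = 1 -> 0 < K -> 0 < e -> K * (hlength h + e) < pi ->
  K * cot (K * (hlength h + e))
    * (dot3 (hpos h 1) (hpos h 1) - dot3 (hpos h 1) n ^+ 2)
  + dot3 (hpos h 1) n ^+ 2 / (hlength h + e) + 4 * K * dot3 (hvert h 1) n
  <= hlength h.
Proof.
move=> n1 K0 e0 Kpi.
have -> : hlength h = len 1 by [].
pose y i s := prim (fun r => h r 0 i) s.
pose t j s := prim (fun r => 2^-1 * Ubil j (hpos h r) (h r)) s.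
(* [P] is the coordinate of the curve along the axis [n], and [W] is its squared distance from that
   axis. *)
pose P s := y 0 s * n 0 0 + y 1 s * n 0 1 + y 2 s * n 0 2.
pose W s := y 0 s ^+ 2 + y 1 s ^+ 2 + y 2 s ^+ 2 - P s ^+ 2.
pose G s := K * cot (K * (len s + e)) * W s + P s ^+ 2 * (len s + e)^-1
  + 4 * K * (t 0 s * n 0 0 + t 1 s * n 0 1 + t 2 s * n 0 2) - len s.
have cy i : cont0y (y i) by apply: cont0y_prim; exact/continuous_cont0y/ch.
have ct i : cont0y (t i) by apply: cont0y_prim; exact: cont0y_hvert.
have cP : cont0y P by rewrite /P; do 2?[apply: cont0yD]; apply: cont0yM => //; exact: cont0y_cst.
have cW : cont0y W.
  rewrite /W; under eq_fun do rewrite !expr2.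
  by apply: cont0yB; [do 2?[apply: cont0yD]; apply: cont0yM|apply: cont0yM].
have lene s : 0 < len s + e by rewrite ltr_wpDl.
(* Since [len] increases up to [len 1], the argument of the cotangent stays strictly between [0] and
   pi on all of [[0, 1]]; the lower bound comes from [e > 0]. *)
have sinK s : 0 <= s <= 1 -> sin (K * (len s + e)) != 0.
  move=> s01; rewrite gt_eqF // sin_gt0_pi // mulr_gt0 //=.
  by apply: le_lt_trans Kpi; rewrite ler_pM2l // lerD2r len_le.
(* Continuity is needed up to the endpoints, while the derivative is computed only inside:
   monotonicity on the closed interval follows from these two facts. *)
have cG : {within `[0, 1], continuous G}.
  apply/subspace_continuousP => s s01.
  have cc f : cont0y f -> f @ within `[0, 1] (nbhs s) --> f s.
    by move=> /(_ 1) /subspace_continuousP; apply.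
  have cl : (len r + e) @[r --> within `[0, 1] (nbhs s)] --> len s + e.
    by apply: cvgD; [exact: cc|exact: cvg_cst].
  apply: cvgB; last exact: cc.
  apply: cvgD; last first.
    apply: cvgM; first exact: cvg_cst.
    by apply: cvgD; [apply: cvgD|]; apply: cvgM; (exact: cc || exact: cvg_cst).
  apply: cvgD.
    apply: cvgM; last exact: cc.
    apply: cvgM; first exact: cvg_cst.
    apply: continuous_cvg_cot; last by apply: cvgM => //; exact: cvg_cst.
    by apply: sinK; move: s01; rewrite /= in_itv.
  apply: cvgM; first by under eq_fun do rewrite expr2; apply: cvgM; exact: cc.
  by apply: cvgV => //; rewrite gt_eqF.
have dG s : 0 < s < 1 -> exists2 d, is_derive s (1 : R) G d & d <= 0.
  move=> /andP[s0 s1].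
  have dy i : is_derive s (1 : R) (y i) (h s 0 i).
    by apply: is_derive_prim => //; exact/continuous_cont0y/ch.
  have dt i : is_derive s (1 : R) (t i) (2^-1 * Ubil i (hpos h s) (h s)).
    by apply: is_derive_prim => //; exact: cont0y_hvert.
  have dl := dlen s0.
  have sn : sin (K * (len s + e)) != 0 by apply: sinK; rewrite !ltW.
  have ln0 : len s + e != 0 by rewrite gt_eqF.
  pose vn := h s 0 0 * n 0 0 + h s 0 1 * n 0 1 + h s 0 2 * n 0 2.
  have dP : is_derive s (1 : R) P vn.
    have dc c : is_derive s (1 : R) (fun=> c : R) 0 by exact: is_derive_cst.
    have := is_derive1D (is_derive1D (is_derive1M (dy 0) (dc (n 0 0)))
      (is_derive1M (dy 1) (dc (n 0 1)))) (is_derive1M (dy 2) (dc (n 0 2))).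
    by move=> /is_derive_eq; apply; rewrite /vn; ring.
  have dW : is_derive s (1 : R) W
      (2 * (y 0 s * h s 0 0 + y 1 s * h s 0 1 + y 2 s * h s 0 2) - 2 * P s * vn).
    have := is_derive1B (is_derive1D (is_derive1D (is_derive1X2 (dy 0))
      (is_derive1X2 (dy 1))) (is_derive1X2 (dy 2))) (is_derive1X2 dP).
    by move=> /is_derive_eq; apply; ring.
  have dle : is_derive s (1 : R) (fun r => len r + e) (norm3 (h s)).
    have := is_derive1D dl (is_derive_cst e s (1 : R)).
    by move=> /is_derive_eq; apply; rewrite addr0.
  have dKl : is_derive s (1 : R) (fun r => K * (len r + e)) (K * norm3 (h s)).
    have := is_derive1M (is_derive_cst K s (1 : R)) dle.
    by move=> /is_derive_eq; apply; rewrite mul0r add0r.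
  have dKc : is_derive s (1 : R) (fun r => K * cot (K * (len r + e)))
      (K * (- (K * norm3 (h s)) / sin (K * (len s + e)) ^+ 2)).
    have := is_derive1M (is_derive_cst K s (1 : R))
      (@is_derive1_cot R (fun r => K * (len r + e)) s _ sn dKl).
    by move=> /is_derive_eq; apply; rewrite mul0r add0r.
  have dT : is_derive s (1 : R)
      (fun s => 4 * K * (t 0 s * n 0 0 + t 1 s * n 0 1 + t 2 s * n 0 2))
      (4 * K * (2^-1 * Ubil 0 (hpos h s) (h s) * n 0 0
        + 2^-1 * Ubil 1 (hpos h s) (h s) * n 0 1
        + 2^-1 * Ubil 2 (hpos h s) (h s) * n 0 2)).
    have dc c : is_derive s (1 : R) (fun=> c : R) 0 by exact: is_derive_cst.
    have := is_derive1M (dc (4 * K)) (is_derive1D (is_derive1D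
      (is_derive1M (dt 0) (dc (n 0 0))) (is_derive1M (dt 1) (dc (n 0 1))))
      (is_derive1M (dt 2) (dc (n 0 2)))).
    move=> /is_derive_eq; apply.
    move: (Ubil 0 _ _) (Ubil 1 _ _) (Ubil 2 _ _) (t 0 s) (t 1 s) (t 2 s) => u0 u1 u2 t0 t1 t2.
    by ring.
  have := is_derive1B (is_derive1D (is_derive1D (is_derive1M dKc dW)
     (is_derive1M (is_derive1X2 dP) (@is_derive1V R (fun r => len r + e) s _ ln0 dle))) dT) dl.
  set d := (X in is_derive _ _ _ X) => dG; exists d; first exact: dG.
  (* With [q = K cot (K (len s + e))] and [isg = 1 / (len s + e)], the left-hand side of the
     inequality is the derivative [d]. *)
  have := @calibration_le0 R (y 0 s) (y 1 s) (y 2 s) (h s 0 0) (h s 0 1) (h s 0 2)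
    (n 0 0) (n 0 1) (n 0 2) (norm3 (h s)) (K * cot (K * (len s + e))) K (len s + e)^-1
    (P s) vn (W s).
  have nE : n 0 0 ^+ 2 + n 0 1 ^+ 2 + n 0 2 ^+ 2 = 1 by rewrite -n1 dot3E; ring.
  have hE : norm3 (h s) ^+ 2 = h s 0 0 ^+ 2 + h s 0 1 ^+ 2 + h s 0 2 ^+ 2.
    by rewrite sqr_norm3 dot3E; ring.
  move=> /(_ nE (sqrtr_ge0 _) hE erefl erefl erefl); congr (_ <= _).
  (* The derivative of [K cot (K (len + e))] is [- |h| K^2 / sin^2]; this identity turns it into
     [- |h| (K^2 + q^2)], the coefficient of [W] in [calibration_le0]. *)
  have csc : (sin (K * (len s + e)) ^+ 2)^-1 = 1 + cot (K * (len s + e)) ^+ 2.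
    transitivity ((cos (K * (len s + e)) ^+ 2 + sin (K * (len s + e)) ^+ 2)
      * (sin (K * (len s + e)) ^+ 2)^-1); first by rewrite cos2Dsin2 mul1r.
    by rewrite /cot; move: (sin _) (cos _) sn => S C S0; field.
  rewrite /d csc Ubil0E Ubil1E Ubil2E !hposE -!/(y _ s).
  move: (y 0 s) (y 1 s) (y 2 s) (P s) (W s) (cot _) (norm3 _) ln0 => y0 y1 y2 p w c l.
  move: (len s + e) (vn) => sg v sg0.
  by field.
have G10 : G 1 <= G 0.
  have i0 : (0 : R) \in `[0, 1] by rewrite in_itv /= lexx ler01.
  have i1 : (1 : R) \in `[0, 1] by rewrite in_itv /= lexx ler01.
  refine (@ler0_derive1_le_cc _ G 0 1 _ _ cG 1 0 i1 i0 ler01).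
    by move=> x; rewrite in_itv /= => /dG[d [] ].
  by move=> x; rewrite in_itv /= => /dG[d [_ dv]]; rewrite derive1E dv.
have y0 i : y i 0 = 0 by exact: prim0.
have t0 i : t i 0 = 0 by exact: prim0.
have G00 : G 0 = 0.
  have P0 : P 0 = 0 by rewrite /P !y0 !mul0r !addr0.
  have W0 : W 0 = 0 by rewrite /W !y0 P0 expr0n /= !addr0 subrr.
  rewrite /G P0 W0 !t0 /len prim0; ring.
move: G10; rewrite G00 /G subr_le0; apply: le_trans; rewrite le_eqVlt; apply/orP; left; apply/eqP.
rewrite !dot3E !hposE !hvertE -!/(y _ 1) -!/(t _ 1) /W /P.
by congr (_ * _ + _ + _); ring.
Qed.

End ContinuousControl.

Lemma dot3Zr (R : realType) (c : R) (u v : 'rV[R]_3) : dot3 u (c *: v) = c * dot3 u v.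
Proof. by rewrite !dot3E !mxE; ring. Qed.

Lemma dot3C (R : realType) (u v : 'rV[R]_3) : dot3 u v = dot3 v u.
Proof. by rewrite !dot3E; ring. Qed.

Lemma hlength_ge0 (R : realType) (h : R -> 'rV[R]_3) : 0 <= hlength h.
Proof. by apply: Rintegral_ge0 => r _; exact: sqrtr_ge0. Qed.

Lemma phi_le_sqr_hlength_continuous (R : realType) (h : R -> 'rV[R]_3) (tau : 'rV[R]_3) :
  (forall i, continuous (fun s => h s 0 i)) -> 0 < norm3 tau < pi ->
  phi (hpos h 1) (hvert h 1) tau <= hlength h ^+ 2.
Proof.
move=> ch /andP[w0 wpi]; set w := norm3 tau in w0 wpi *; set L := hlength h.
have L0 : 0 <= L := hlength_ge0 h.
suff key e : 0 < e -> phi (hpos h 1) (hvert h 1) tau <= L * (L + e).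
  apply/ler_addgt0Pr => d d0; have L1 : 0 < L + 1 by rewrite ltr_wpDl.
  (* With [e = d / (L + 1)] one has [L * e <= d], also when [L = 0]. *)
  apply: (le_trans (key (d / (L + 1)) _)); first by rewrite divr_gt0.
  rewrite mulrDr -expr2 lerD2l mulrA ler_pdivrMr // mulrC ler_pM2l //.
  by rewrite lerDl.
move=> e0; have Le : 0 < L + e by rewrite ltr_wpDl.
have Le0 : L + e != 0 by rewrite gt_eqF.
have wn0 : w != 0 by rewrite gt_eqF.
have n1 : dot3 (w^-1 *: tau) (w^-1 *: tau) = 1.
  by rewrite dot3Zr dot3C dot3Zr -sqr_norm3 -/w; field.
(* The choice [K = w / (L + e)] makes the final argument of the cotangent equal to [w = |tau|].
   Multiplying the calibration inequality by [L + e] then turns its left-hand side into [phi]. *)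
have KE : w / (L + e) * (L + e) = w by rewrite divfK.
have := @calibration_length _ _ ch _ (w / (L + e)) e n1.
rewrite divr_gt0 // KE wpi => /(_ isT e0 isT).
rewrite -/L -(ler_pM2r Le); congr (_ <= _).
rewrite !dot3Zr /phi /scot /psi -/w (negbTE wn0) sqr_norm3 (dot3C tau).
by move: (cot w) (dot3 _ _) (dot3 _ _) (dot3 _ _) => c p q r; field; rewrite wn0 Le0.
Qed.

(** * Continuity of positions and areas for the L^1 norm of the velocity *)

Section Density.
Variable R : realType.
Notation mu := (@lebesgue_measure R).
Implicit Types (f g : R -> R) (s : R).
Local Notation int01 f := (mu.-integrable `[0%R, 1%R] (EFin \o f)).

Lemma int01_subset f s : s <= 1 -> int01 f -> mu.-integrable `[0, s] (EFin \o f).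
Proof. by move=> s1; apply: integrableS => //; apply: subset_itvl; rewrite bnd_simp. Qed.

Lemma int01B f g : int01 f -> int01 g -> int01 (fun r => f r - g r).
Proof. by move=> fi gi; apply: (integrableB _ fi gi). Qed.

Lemma int01_norm f : int01 f -> int01 (fun r => `|f r|).
Proof. by move=> fi; apply: (integrable_norm fi). Qed.

(** The bound is uniform in [s]: the integral of [|f|] only grows when the interval is enlarged to
    [[0, 1]]. *)
Lemma prim_norm_le f s : s <= 1 -> int01 f ->
  `|prim f s| <= prim (fun r => `|f r|) 1.
Proof.
move=> s1 fi; have fs := int01_subset s1 fi.
apply: (le_trans (le_normr_Rintegral _ fs)) => //.
apply: fine_le.
- apply: integrable_fin_num => //; exact: integrable_norm.
- apply: integrable_fin_num => //; exact: int01_norm.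
apply: ge0_subset_integral => //.
  exact: (measurable_int mu (int01_norm fi)).
by apply: subset_itvl; rewrite bnd_simp.
Qed.

Lemma primB f g : int01 f -> int01 g ->
  prim (fun r => f r - g r) 1 = prim f 1 - prim g 1.
Proof. by move=> fi gi; exact: RintegralB. Qed.

Lemma prim_dist_le f g s : s <= 1 -> int01 f -> int01 g ->
  `|prim f s - prim g s| <= prim (fun r => `|f r - g r|) 1.
Proof.
move=> s1 fi gi; rewrite -RintegralB //; [|exact: int01_subset..].
exact/prim_norm_le/int01B.
Qed.

Lemma le_prim1 f g : int01 f -> int01 g -> (forall r, 0 <= r <= 1 -> f r <= g r) ->
  prim f 1 <= prim g 1.
Proof.
by move=> fi gi fg; apply: le_Rintegral => // r; rewrite /= in_itv; exact: fg.
Qed.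

(** A primitive is continuous, hence measurable, and bounded by the L^1 norm of [f]; its product
    with an integrable function is therefore integrable. *)
Lemma int01_prim_mul f g : int01 f -> int01 g -> int01 (fun r => prim f r * g r).
Proof.
move=> fi gi; apply: (@integrableMr _ _ _ mu `[0%R, 1%R] _ (prim f) (EFin \o g)) => //.
  apply: subspace_continuous_measurable_fun => //.
  exact: integrable_prim_cont.
exists (prim (fun r => `|f r|) 1); split; first exact: num_real.
move=> M ltM r; rewrite /= in_itv /= => /andP[_ r1].
exact: le_trans (prim_norm_le r1 fi) (ltW ltM).
Qed.

(** The difference of the integrands is [(F - F') g' + F (g - g')], where [F] and [F'] are the
    primitives. Writing [g'] as [g - (g - g')] keeps the norm of [g'] out of the bound, which thus
    visibly tends to [0] when [f'] tends to [f] and [g'] to [g]. *)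
Lemma area_dist_le f f' g g' : int01 f -> int01 f' -> int01 g -> int01 g' ->
  `|prim (fun r => prim f r * g r) 1 - prim (fun r => prim f' r * g' r) 1|
  <= prim (fun r => `|f r - f' r|) 1
       * (prim (fun r => `|g r|) 1 + prim (fun r => `|g r - g' r|) 1)
     + prim (fun r => `|f r|) 1 * prim (fun r => `|g r - g' r|) 1.
Proof.
move=> fi fi' gi gi'.
set df := prim (fun r => `|f r - f' r|) 1.
set dg := prim (fun r => `|g r - g' r|) 1.
have gg := int01B gi gi'.
have i1 := int01_prim_mul fi gi; have i2 := int01_prim_mul fi' gi'.
rewrite -primB //.
apply: (le_trans (prim_norm_le (lexx _) (int01B i1 i2))).
have nZ (c : R) k : int01 k -> int01 (fun r => c * k r).
  by move=> ki; apply: (integrableZl _ c ki).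
have nD k l : int01 k -> int01 l -> int01 (fun r => k r + l r).
  by move=> ki li; apply: (integrableD _ ki li).
have ng := int01_norm gi; have ngg := int01_norm gg.
pose b r := df * (`|g r| + `|g r - g' r|) + prim (fun r => `|f r|) 1 * `|g r - g' r|.
have bi : int01 b by apply: (nD); apply: (nZ) => //; apply: (nD).
apply: (le_trans (@le_prim1 _ b (int01_norm (int01B i1 i2)) bi _)); last first.
  rewrite /b /prim RintegralD //; [|by apply: (nZ); apply: (nD)|by apply: (nZ)].
  by rewrite !RintegralZl // ?RintegralD //; apply: (nD).
move=> r /andP[_ r1]; rewrite /b.
have -> : prim f r * g r - prim f' r * g' r =
  (prim f r - prim f' r) * (g r - (g r - g' r)) + prim f r * (g r - g' r) by ring.
apply: (le_trans (ler_normD _ _)); rewrite !normrM; apply: lerD; apply: ler_pM => //.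
- exact: prim_dist_le.
- exact: ler_normB.
- exact: prim_norm_le.
Qed.

Lemma continuous_approximation f : int01 f ->
  exists g : nat -> R -> R, (forall k, continuous (g k)) /\
    prim (fun r => `|f r - g k r|) 1 @[k --> \oo] --> (0 : R).
Proof.
move=> fi; have m01 : (mu `[0%R, 1%R] < +oo)%E.
  by rewrite lebesgue_measure_itv /=; case: ifP => _; rewrite ?sube0 ltry.
have [|g [cg _ lim]] := approximation_continuous_integrable _ m01 fi; first exact: measurable_itv.
by exists g; split => //; exact: fine_cvg lim.
Qed.

End Density.

(** * The lower bound for integrable velocities *)

Section LowerBound.
Variable R : realType.
Notation mu := (@lebesgue_measure R).
Implicit Types (f g : R -> R) (s : R) (h : R -> 'rV[R]_3) (u v : 'rV[R]_3).
Local Notation int01 f := (mu.-integrable `[0%R, 1%R] (EFin \o f)).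

Lemma norm_coord_le_norm3 u i : `|u 0 i| <= norm3 u.
Proof.
rewrite -sqrtr_sqr ler_sqrt ?dot3_ge0 // dot3E.
have := sqr_ge0 (u 0 0); have := sqr_ge0 (u 0 1); have := sqr_ge0 (u 0 2).
by elim/ord3P: i; rewrite !expr2 => ? ? ?; lra.
Qed.

(** Expand [|u|^2] around [v], bound each [v_i (u_i - v_i)] by [|v| |u_i - v_i|], and compare with
    the square of the right-hand side, whose remaining cross terms are nonnegative. *)
Lemma norm3_le_sum u v : norm3 u <=
  norm3 v + (`|u 0 0 - v 0 0| + `|u 0 1 - v 0 1| + `|u 0 2 - v 0 2|).
Proof.
set a := `|_ - _|; set b := `|_ - _|; set c := `|_ - _|.
have nv : 0 <= norm3 v := sqrtr_ge0 _.
have s0 : 0 <= norm3 v + (a + b + c) by rewrite !addr_ge0 // normr_ge0.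
rewrite -(ler_pXn2r (_ : 0 < 2)%N) // ?nnegrE ?sqrtr_ge0 // sqr_norm3.
have -> : dot3 u u = dot3 v v + 2 * (v 0 0 * (u 0 0 - v 0 0) + v 0 1 * (u 0 1 - v 0 1)
   + v 0 2 * (u 0 2 - v 0 2)) + ((u 0 0 - v 0 0) ^+ 2 + (u 0 1 - v 0 1) ^+ 2
   + (u 0 2 - v 0 2) ^+ 2).
  by rewrite !dot3E; ring.
have vd i : v 0 i * (u 0 i - v 0 i) <= norm3 v * `|u 0 i - v 0 i|.
  apply: (le_trans (ler_norm _)); rewrite normrM.
  by rewrite ler_wpM2r // norm_coord_le_norm3.
have := vd 0; have := vd 1; have := vd 2.
rewrite -/a -/b -/c -sqr_norm3.
rewrite -[(u 0 0 - v 0 0) ^+ 2]real_normK ?num_real //.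
rewrite -[(u 0 1 - v 0 1) ^+ 2]real_normK ?num_real //.
rewrite -[(u 0 2 - v 0 2) ^+ 2]real_normK ?num_real // -/a -/b -/c.
have a0 : 0 <= a := normr_ge0 _; have b0 : 0 <= b := normr_ge0 _.
have c0 : 0 <= c := normr_ge0 _.
have := mulr_ge0 a0 b0; have := mulr_ge0 a0 c0; have := mulr_ge0 b0 c0.
move: (v 0 0 * _) (v 0 1 * _) (v 0 2 * _) => x y z.
move: (norm3 v) a b c {vd nv s0 a0 b0 c0} => n a b c.
by nra.
Qed.

Lemma norm3_dist_le u v : `|norm3 u - norm3 v| <=
  `|u 0 0 - v 0 0| + `|u 0 1 - v 0 1| + `|u 0 2 - v 0 2|.
Proof.
rewrite ler_norml lerNl opprB !lerBlDl norm3_le_sum andbT.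
by rewrite (distrC (u 0 0)) (distrC (u 0 1)) (distrC (u 0 2)) norm3_le_sum.
Qed.

Lemma int01_norm3 h : admissible_control h -> int01 (fun r => norm3 (h r)).
Proof.
move=> hi; have mh i : measurable_fun (`[0%R, 1%R] : set R) (fun r : R => h r 0 i).
  by apply/measurable_EFinP; exact: (measurable_int mu (hi i)).
have nD k l : int01 k -> int01 l -> int01 (fun r => k r + l r).
  by move=> ki li; apply: (integrableD _ ki li).
have bi : int01 (fun r => `|h r 0 0| + `|h r 0 1| + `|h r 0 2|).
  by apply: (nD); [apply: (nD)|]; apply: int01_norm; exact: hi.
apply: (le_integrable _ _ _ bi) => //.
- have md : measurable_fun (`[0%R, 1%R] : set R) (fun r : R => dot3 (h r) (h r)).
    rewrite (_ : (fun r => _) =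
      fun r => h r 0 0 * h r 0 0 + h r 0 1 * h r 0 1 + h r 0 2 * h r 0 2).
      by apply: measurable_funD; [apply: measurable_funD|]; apply: measurable_funM.
    by apply/funext => r; rewrite dot3E.
  apply/measurable_EFinP.
  exact: (measurableT_comp (continuous_measurable_fun (@sqrt_continuous R)) md).
- move=> r _; rewrite /= lee_fin [leLHS]ger0_norm ?sqrtr_ge0 // [leRHS]ger0_norm ?addr_ge0 //.
  have := norm3_le_sum (h r) 0.
  have -> : norm3 (0 : 'rV[R]_3) = 0.
    by rewrite /norm3 dot3E !mxE !mulr0 !addr0 sqrtr0.
  by rewrite !mxE !subr0 add0r.
Qed.

Lemma cvg_dist_le (u v : nat -> R) (l : R) : (forall k, `|l - u k| <= v k) ->
  v k @[k --> \oo] --> (0 : R) -> u k @[k --> \oo] --> l.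
Proof.
move=> uv v0; apply/cvgrPdist_le => e e0.
have /cvgrPdist_le/(_ e e0) := v0; apply: filterS => k.
rewrite sub0r normrN; apply: le_trans; apply: le_trans (uv k) _.
exact: ler_norm.
Qed.

Lemma phi_le_sqr_hlength h (tau : 'rV[R]_3) :
  admissible_control h -> 0 < norm3 tau < pi ->
  phi (hpos h 1) (hvert h 1) tau <= hlength h ^+ 2.
Proof.
move=> hi wpi.
have /choice[g gP] : forall i, exists gi : nat -> R -> R,
    (forall k, continuous (gi k)) /\
    prim (fun r => `|h r 0 i - gi k r|) 1 @[k --> \oo] --> (0 : R).
  by move=> i; exact: continuous_approximation (hi i).
pose H k r : 'rV[R]_3 := \row_i g i k r.
have HE k i : (fun r => H k r 0 i) = g i k by apply/funext => r; rewrite mxE.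
have gi i k : int01 (g i k).
  by apply/cont0y_integrable/continuous_cont0y; case: (gP i).
have Hi k : admissible_control (H k).
  by move=> i; rewrite (_ : (fun r => _) = EFin \o g i k) //; apply/funext => r; rewrite /= mxE.
have d0 i : prim (fun r => `|h r 0 i - g i k r|) 1 @[k --> \oo] --> (0 : R) by case: (gP i).
have cpos i : hpos (H k) 1 0 i @[k --> \oo] --> hpos h 1 0 i.
  apply: cvg_dist_le (d0 i) => k; rewrite !hposE HE.
  by apply: prim_dist_le => //; exact: hi.
(* By bilinearity the vertical endpoint is built from these iterated integrals of pairs of velocity
   coordinates, so its convergence reduces to [area_dist_le]. *)
pose A f f' := prim (fun r => prim f r * f' r) 1.
have cA i j : A (g i k) (g j k) @[k --> \oo] --> A (fun r => h r 0 i) (fun r => h r 0 j).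
  apply: (@cvg_dist_le _ (fun k => prim (fun r => `|h r 0 i - g i k r|) 1
       * (prim (fun r => `|h r 0 j|) 1 + prim (fun r => `|h r 0 j - g j k r|) 1)
     + prim (fun r => `|h r 0 i|) 1 * prim (fun r => `|h r 0 j - g j k r|) 1)).
    by move=> k; apply: area_dist_le => //; exact: hi.
  rewrite [X in _ --> X](_ : 0 = 0 * (prim (fun r => `|h r 0 j|) 1 + 0)
     + prim (fun r => `|h r 0 i|) 1 * 0); last by rewrite mul0r mulr0 addr0.
  apply: cvgD; apply: cvgM => //; try exact: cvg_cst.
  by apply: cvgD => //; exact: cvg_cst.
have vertE (h' : R -> 'rV[R]_3) : admissible_control h' ->
   let B i j := A (fun r => h' r 0 i) (fun r => h' r 0 j) in
   [/\ hvert h' 1 0 0 = 2^-1 * (B 2 1 - B 1 2), hvert h' 1 0 1 = 2^-1 * (B 0 2 - B 2 0)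
     & hvert h' 1 0 2 = 2^-1 * (B 1 0 - B 0 1)].
  move=> h'i B; have Bi i j : int01 (fun r => prim (fun r => h' r 0 i) r * h' r 0 j).
    by apply: int01_prim_mul; exact: h'i.
  have primZ k : int01 k -> prim (fun r => 2^-1 * k r) 1 = 2^-1 * prim k 1.
    by move=> ki; exact: RintegralZl.
  split; rewrite hvertE /B /A -primB //.
  - rewrite -(primZ _ (int01B (Bi 2 1) (Bi 1 2))).
    by apply: eq_Rintegral => r _; rewrite Ubil0E !hposE.
  - rewrite -(primZ _ (int01B (Bi 0 2) (Bi 2 0))).
    by apply: eq_Rintegral => r _; rewrite Ubil1E !hposE.
  - rewrite -(primZ _ (int01B (Bi 1 0) (Bi 0 1))).
    by apply: eq_Rintegral => r _; rewrite Ubil2E !hposE.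
have cvert j : hvert (H k) 1 0 j @[k --> \oo] --> hvert h 1 0 j.
  have cB i l : A (fun r => H k r 0 i) (fun r => H k r 0 l) @[k --> \oo] -->
      A (fun r => h r 0 i) (fun r => h r 0 l).
    by under eq_fun do rewrite !HE; exact: cA.
  have [e0 e1 e2] := vertE _ hi.
  elim/ord3P: j; rewrite (e0, e1, e2).
  - rewrite (_ : (fun k => _) = fun k => 2^-1 * (A (fun r => H k r 0 2) (fun r => H k r 0 1)
       - A (fun r => H k r 0 1) (fun r => H k r 0 2))).
      by apply: cvgM; [exact: cvg_cst|apply: cvgB].
    by apply/funext => k; have [] := vertE _ (Hi k).
  - rewrite (_ : (fun k => _) = fun k => 2^-1 * (A (fun r => H k r 0 0) (fun r => H k r 0 2)
       - A (fun r => H k r 0 2) (fun r => H k r 0 0))).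
      by apply: cvgM; [exact: cvg_cst|apply: cvgB].
    by apply/funext => k; have [] := vertE _ (Hi k).
  - rewrite (_ : (fun k => _) = fun k => 2^-1 * (A (fun r => H k r 0 1) (fun r => H k r 0 0)
       - A (fun r => H k r 0 0) (fun r => H k r 0 1))).
      by apply: cvgM; [exact: cvg_cst|apply: cvgB].
    by apply/funext => k; have [] := vertE _ (Hi k).
have clen : hlength (H k) @[k --> \oo] --> hlength h.
  pose D i k r := `|h r 0 i - g i k r|.
  have Di i k : int01 (D i k) by apply/int01_norm/int01B => //; exact: hi.
  have nD k l : int01 k -> int01 l -> int01 (fun r => k r + l r).
    by move=> ki li; apply: (integrableD _ ki li).
  apply: (@cvg_dist_le _ (fun k => prim (D 0 k) 1 + prim (D 1 k) 1 + prim (D 2 k) 1)).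
    move=> k; have i1 := int01_norm3 hi; have i2 := int01_norm3 (Hi k).
    rewrite /hlength -RintegralB //.
    apply: (le_trans (prim_norm_le (lexx _) (int01B i1 i2))).
    rewrite /prim -!RintegralD //; last by apply: (nD).
    apply: le_prim1; [exact/int01_norm/int01B|by apply: (nD) => //; apply: (nD)|].
    by move=> r _; have := norm3_dist_le (h r) (H k r); rewrite !mxE.
  rewrite [X in _ --> X](_ : 0 = 0 + 0 + 0); last by rewrite !addr0.
  by apply: cvgD; [apply: cvgD|]; exact: d0.
(* For fixed [tau], [phi] is a polynomial in the coordinates of the endpoint; squares are written as
   products so that limits of sums and products suffice. *)
have phiE x t : phi x t tau = (x 0 0 * x 0 0 + x 0 1 * x 0 1 + x 0 2 * x 0 2) * scot (norm3 tau)
   + psi (norm3 tau) * ((tau 0 0 * x 0 0 + tau 0 1 * x 0 1 + tau 0 2 * x 0 2)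
      * (tau 0 0 * x 0 0 + tau 0 1 * x 0 1 + tau 0 2 * x 0 2))
   + 4 * (t 0 0 * tau 0 0 + t 0 1 * tau 0 1 + t 0 2 * tau 0 2).
  by rewrite /phi sqr_norm3 !dot3E expr2.
have cphi : phi (hpos (H k) 1) (hvert (H k) 1) tau @[k --> \oo] -->
    phi (hpos h 1) (hvert h 1) tau.
  under eq_fun do rewrite phiE.
  rewrite phiE.
  have cc c : (c : R) @[k --> \oo] --> c by exact: cvg_cst.
  have cD (a b : nat -> R) (p q : R) : a @ \oo --> p -> b @ \oo --> q ->
    (fun k => a k + b k) @ \oo --> p + q by exact: cvgD.
  have cM (a b : nat -> R) (p q : R) : a @ \oo --> p -> b @ \oo --> q ->
    (fun k => a k * b k) @ \oo --> p * q by exact: cvgM.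
  have cxx i := cM _ _ _ _ (cpos i) (cpos i).
  have ctx i := cM _ _ _ _ (cc (tau 0 i)) (cpos i).
  have ctt i := cM _ _ _ _ (cvert i) (cc (tau 0 i)).
  have ct3 := cD _ _ _ _ (cD _ _ _ _ (ctx 0) (ctx 1)) (ctx 2).
  exact: (cD _ _ _ _ (cD _ _ _ _
    (cM _ _ _ _ (cD _ _ _ _ (cD _ _ _ _ (cxx 0) (cxx 1)) (cxx 2)) (cc (scot (norm3 tau))))
    (cM _ _ _ _ (cc (psi (norm3 tau))) (cM _ _ _ _ ct3 ct3)))
    (cM _ _ _ _ (cc 4) (cD _ _ _ _ (cD _ _ _ _ (ctt 0) (ctt 1)) (ctt 2)))).
have cL2 : hlength (H k) ^+ 2 @[k --> \oo] --> hlength h ^+ 2.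
  by under eq_fun do rewrite expr2; rewrite expr2; apply: cvgM.
apply: (ler_cvg_to cphi cL2); apply: nearW => k.
apply: phi_le_sqr_hlength_continuous => // i.
by rewrite HE; case: (gP i).
Qed.

End LowerBound.

(** * The derivative of [psi], and the helix with its endpoint and length *)

Section Geodesic.
Variable R : realType.
Notation mu := (@lebesgue_measure R).

Lemma prim_antiderivative (f F : R -> R) (s : R) : 0 <= s -> continuous f ->
  (forall x, is_derive x (1 : R) F (f x)) -> prim f s = F s - F 0.
Proof.
rewrite le_eqVlt => /predU1P[<- _ _|s0 cf dF]; first by rewrite prim0 subrr.
have cF : continuous F.
  by move=> x; apply: differentiable_continuous; apply/derivable1_diffP; case: (dF x).
rewrite /prim /Rintegral (@continuous_FTC2 _ _ F) //.
- exact: continuous_subspaceT.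
- by split => [x _||]; [case: (dF x)|apply/cvg_at_right_filter/cF|apply/cvg_at_left_filter/cF].
- by move=> x _; rewrite derive1E; case: (dF x).
Qed.

Lemma eq_prim1 (g f : R -> R) : (forall r, 0 <= r <= 1 -> f r = g r) ->
  prim f 1 = prim g 1.
Proof. by move=> fg; apply: eq_Rintegral => r; rewrite inE /= in_itv; exact: fg. Qed.

Lemma is_derive1_psi (w : R) : w != 0 -> sin w != 0 ->
  derive1 psi w = - 2 / w ^+ 3 + cot w / w ^+ 2 + (w * sin w ^+ 2)^-1.
Proof.
move=> w0 s0; rewrite derive1E.
(* Near [w != 0] the exceptional value of [psi] at [0] is not seen. *)
rewrite (@near_eq_derive _ _ _ psi (fun s => (1 - s * cot s) * (s ^+ 2)^-1)); last first.
  near=> s; rewrite /psi ifF //; apply/negbTE; near: s.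
  exact: (@open_neq R 0 w).
have w2 : w ^+ 2 != 0 by rewrite expf_neq0.
have did : is_derive w (1 : R) (fun s : R => s) 1 by exact: is_derive_id.
have := is_derive1M (is_derive1B (is_derive_cst (1 : R) w (1 : R))
  (is_derive1M did (is_derive1_cot s0 did)))
  (@is_derive1V R (fun s => s ^+ 2) w _ w2 (is_derive1X2 did)).
move=> [_ ->]; rewrite /cst; move: (cot w) (sin w) s0 => c s s0.
by field; rewrite s0 w0.
Unshelve. all: by end_near. Qed.

Variables (w c1 c2 a : R).
Implicit Types s : R.
Hypotheses (w0 : w != 0) (sw0 : sin w != 0) (c12 : c1 ^+ 2 + c2 ^+ 2 = 1).

(** Signed radius of the circular motion. Its chord [2 b sin w] has to be [a c2], the component of
    the endpoint [a e1] orthogonal to the axis. *)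
Let b := a * c2 / (2 * sin w).
(** The phase runs from [- w] to [w]; this symmetry about the midpoint cancels the displacement
    along [e3]. *)
Let S (s : R) := sin (w * (2 * s - 1)).
Let C (s : R) := cos (w * (2 * s - 1)).

(* In the orthonormal frame [n = (c1, c2, 0)], [m = (c2, -c1, 0)], [e3], the velocity is
   [a c1 n + 2 b w (cos (w (2 s - 1)) m + sin (w (2 s - 1)) e3)]. *)
Definition geodesic_control s : 'rV[R]_3 := \row_i
  [:: a * c1 ^+ 2 + 2 * b * w * c2 * C s; a * c1 * c2 - 2 * b * w * c1 * C s;
      2 * b * w * S s]`_i.

Let dw s : is_derive s (1 : R) (fun s => w * (2 * s - 1)) (2 * w).
Proof.
have did : is_derive s (1 : R) (fun s : R => s) 1 by exact: is_derive_id.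
have := is_derive1M (is_derive_cst w s (1 : R)) (is_derive1B (is_derive1M
  (is_derive_cst (2 : R) s (1 : R)) did) (is_derive_cst (1 : R) s (1 : R))).
by move=> /is_derive_eq; apply; rewrite /cst; ring.
Qed.

Let dS s : is_derive s (1 : R) S (C s * (2 * w)).
Proof. exact: (is_derive1_comp (is_derive_sin _) (dw s)). Qed.

Let dC s : is_derive s (1 : R) C (- S s * (2 * w)).
Proof. exact: (is_derive1_comp (is_derive_cos _) (dw s)). Qed.

Let is_derive_continuous (f df : R -> R) :
  (forall x, is_derive x (1 : R) f (df x)) -> continuous f.
Proof.
by move=> fd x; apply: differentiable_continuous; apply/derivable1_diffP; case: (fd x).
Qed.

Let dcst (c : R) s : is_derive s (1 : R) (fun _ : R => c) 0.
Proof. exact: is_derive_cst. Qed.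

Let did s : is_derive s (1 : R) (fun s : R => s) 1.
Proof. exact: is_derive_id. Qed.

Let cS : continuous S := is_derive_continuous dS.
Let cC : continuous C := is_derive_continuous dC.

Let ccst (c : R) : continuous (fun _ : R => c).
Proof. by move=> x; exact: cvg_cst. Qed.

Let cD (f g : R -> R) : continuous f -> continuous g -> continuous (fun s => f s + g s).
Proof. by move=> cf cg x; apply: cvgD; [exact: cf|exact: cg]. Qed.

Let cB (f g : R -> R) : continuous f -> continuous g -> continuous (fun s => f s - g s).
Proof. by move=> cf cg x; apply: cvgB; [exact: cf|exact: cg]. Qed.

Let cM (f g : R -> R) : continuous f -> continuous g -> continuous (fun s => f s * g s).
Proof. by move=> cf cg x; apply: cvgM; [exact: cf|exact: cg]. Qed.

Let S0 : S 0 = - sin w. Proof. by rewrite /S mulr0 sub0r mulrN1 sinN. Qed.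
Let C0 : C 0 = cos w. Proof. by rewrite /C mulr0 sub0r mulrN1 cosN. Qed.
Let S1 : S 1 = sin w. Proof. by rewrite /S; congr sin; ring. Qed.
Let C1 : C 1 = cos w. Proof. by rewrite /C; congr cos; ring. Qed.

Let x1 s := a * c1 ^+ 2 * s + b * c2 * (S s + sin w).
Let x2 s := a * c1 * c2 * s - b * c1 * (S s + sin w).
Let x3 s := b * (cos w - C s).

Let h1 s := a * c1 ^+ 2 + 2 * b * w * c2 * C s.
Let h2 s := a * c1 * c2 - 2 * b * w * c1 * C s.
Let h3 s := 2 * b * w * S s.

Let dx1 s : is_derive s (1 : R) x1 (h1 s).
Proof.
have := is_derive1D (is_derive1M (dcst (a * c1 ^+ 2) s) (did s))
  (is_derive1M (dcst (b * c2) s) (is_derive1D (dS s) (dcst (sin w) s))).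
by move=> /is_derive_eq; apply; rewrite /h1; ring.
Qed.

Let dx2 s : is_derive s (1 : R) x2 (h2 s).
Proof.
have := is_derive1B (is_derive1M (dcst (a * c1 * c2) s) (did s))
  (is_derive1M (dcst (b * c1) s) (is_derive1D (dS s) (dcst (sin w) s))).
by move=> /is_derive_eq; apply; rewrite /h2; ring.
Qed.

Let dx3 s : is_derive s (1 : R) x3 (h3 s).
Proof.
have := is_derive1M (dcst b s) (is_derive1B (dcst (cos w) s) (dC s)).
by move=> /is_derive_eq; apply; rewrite /h3; ring.
Qed.

Let ch1 : continuous h1. Proof. by apply: cD => //; apply: cM. Qed.
Let ch2 : continuous h2. Proof. by apply: cB => //; apply: cM. Qed.
Let ch3 : continuous h3. Proof. by apply: cM. Qed.

Let gE s : [/\ geodesic_control s 0 0 = h1 s, geodesic_control s 0 1 = h2 s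
  & geodesic_control s 0 2 = h3 s].
Proof. by split; rewrite mxE. Qed.

Let g0E : (fun s => geodesic_control s 0 0) = h1.
Proof. by apply/funext => s; case: (gE s). Qed.
Let g1E : (fun s => geodesic_control s 0 1) = h2.
Proof. by apply/funext => s; case: (gE s). Qed.
Let g2E : (fun s => geodesic_control s 0 2) = h3.
Proof. by apply/funext => s; case: (gE s). Qed.

Let pos s : 0 <= s -> [/\ hpos geodesic_control s 0 0 = x1 s,
  hpos geodesic_control s 0 1 = x2 s & hpos geodesic_control s 0 2 = x3 s].
Proof.
move=> s0; split; rewrite hposE ?g0E ?g1E ?g2E.
- by rewrite (prim_antiderivative s0 ch1 dx1) /x1 S0; ring.
- by rewrite (prim_antiderivative s0 ch2 dx2) /x2 S0; ring.
- by rewrite (prim_antiderivative s0 ch3 dx3) /x3 C0; ring.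
Qed.

Lemma geodesic_control_admissible : admissible_control geodesic_control.
Proof.
elim/ord3P.
- have := cont0y_integrable 1 (continuous_cont0y ch1).
  by rewrite -g0E.
- have := cont0y_integrable 1 (continuous_cont0y ch2).
  by rewrite -g1E.
- have := cont0y_integrable 1 (continuous_cont0y ch3).
  by rewrite -g2E.
Qed.

Lemma hpos_geodesic : hpos geodesic_control 1 = a *: evec 0.
Proof.
have [p1 p2 p3] := pos ler01.
apply/rowP; elim/ord3P; rewrite (p1, p2, p3) !mxE /=.
- have c11 : c1 ^+ 2 = 1 - c2 ^+ 2 by rewrite -c12; ring.
  by rewrite /x1 S1 /b c11; move: (sin w) sw0 => u u0; field.
- by rewrite /x2 S1 /b; move: (sin w) sw0 => u u0; field.
- by rewrite /x3 C1 subrr; ring.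
Qed.

(** The speed is constant, with component [a c1] along the axis and [2 b w = a c2 w / sin w] along
    the circle. *)
Lemma hlength_geodesic : hlength geodesic_control ^+ 2 =
  a ^+ 2 * (c1 ^+ 2 + (w * c2 / sin w) ^+ 2).
Proof.
have nE s : norm3 (geodesic_control s) = Num.sqrt (a ^+ 2 * (c1 ^+ 2 + (w * c2 / sin w) ^+ 2)).
  rewrite /norm3 dot3E; congr Num.sqrt; have [-> -> ->] := gE s.
  have SC : C s ^+ 2 = 1 - S s ^+ 2 by rewrite /C /S cos2sin2.
  have c22 : c2 ^+ 2 = 1 - c1 ^+ 2 by rewrite -c12; ring.
  rewrite /h1 /h2 /h3 /b.
  by move: (S s) (C s) (sin w) sw0 SC => p q r r0 SC; field: SC c22.
pose c := Num.sqrt (a ^+ 2 * (c1 ^+ 2 + (w * c2 / sin w) ^+ 2)).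
have -> : hlength geodesic_control = prim (fun=> c) 1.
  by apply: (@eq_prim1 (fun=> c)) => s _; exact: nE.
have d s : is_derive s (1 : R) (fun s => c * s) c.
  have := is_derive1M (dcst c s) (did s).
  by move=> /is_derive_eq; apply; ring.
rewrite (prim_antiderivative ler01 (@ccst c) d).
by rewrite mulr1 mulr0 subr0 sqr_sqrtr // mulr_ge0 ?sqr_ge0 // addr_ge0 ?sqr_ge0.
Qed.

Lemma hvert_geodesic :
  let k := cos w - 2 * sin w / w + w / sin w in
  [/\ hvert geodesic_control 1 0 0 = a ^+ 2 * c1 * c2 ^+ 2 / (4 * sin w) * k,
      hvert geodesic_control 1 0 1 = a ^+ 2 * c2 / (4 * sin w)
        * (c2 ^+ 2 * k - 2 * (cos w - sin w / w))
    & hvert geodesic_control 1 0 2 = 0].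
Proof.
(* Up to constants, [e2] is the area density of the circular motion, directed along the axis [n],
   and [e1] is that of the axial motion paired with the motion along [e3], directed along [m]. [E1]
   and [E2] are antiderivatives. The first two vertical coordinates are combinations of the two
   integrals. *)
pose E1 s := cos w * s - w^-1 * S s + s * C s.
pose E2 s := s - (2 * w)^-1 * (cos w * S s + sin w * C s).
pose e1 s := cos w - C s - 2 * w * s * S s.
pose e2 s := 1 - cos w * C s + sin w * S s.
have d1 s : is_derive s (1 : R) E1 (e1 s).
  have := is_derive1D (is_derive1B (is_derive1M (dcst (cos w) s) (did s))
    (is_derive1M (dcst w^-1 s) (dS s))) (is_derive1M (did s) (dC s)).
  by move=> /is_derive_eq; apply; rewrite /e1; move: (S s) (C s) (cos w) => p q r; field.
have d2 s : is_derive s (1 : R) E2 (e2 s).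
  have := is_derive1B (did s) (is_derive1M (dcst (2 * w)^-1 s)
   (is_derive1D (is_derive1M (dcst (cos w) s) (dS s)) (is_derive1M (dcst (sin w) s) (dC s)))).
  by move=> /is_derive_eq; apply; rewrite /e2; move: (S s) (C s) (cos w) (sin w) => p q r t; field.
have cid : continuous (fun s : R => s) by move=> s; exact: cvg_id.
have ce1 : continuous e1.
  by apply: cB; [apply: cB|apply: cM => //; apply: cM].
have ce2 : continuous e2.
  by apply: cD; [apply: cB => //|]; apply: cM.
have comb (p q : R) : prim (fun s => p * e1 s + q * e2 s) 1 =
    p * (2 * (cos w - sin w / w)) + q * (1 - sin w * cos w / w).
  have cpq : continuous (fun s => p * e1 s + q * e2 s) by apply: cD; apply: cM.
  have d s : is_derive s (1 : R) (fun s => p * E1 s + q * E2 s) (p * e1 s + q * e2 s).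
    have := is_derive1D (is_derive1M (dcst p s) (d1 s)) (is_derive1M (dcst q s) (d2 s)).
    by move=> /is_derive_eq; apply; ring.
  rewrite (prim_antiderivative ler01 cpq d) /E1 /E2 S0 C0 S1 C1.
  by move: (sin w) (cos w) => u v; field.
have SC s : C s ^+ 2 = 1 - S s ^+ 2 by rewrite /C /S cos2sin2.
have c11 : c1 ^+ 2 = 1 - c2 ^+ 2 by rewrite -c12; ring.
move=> k; split; rewrite hvertE.
- rewrite (@eq_prim1 (fun s => (2^-1 * b * c1 * a * c2) * e1 s
     + (b ^+ 2 * w * c1) * e2 s)).
    rewrite comb /k /b.
    by move: (sin w) (cos w) sw0 => u v u0; field; rewrite u0 w0.
  move=> s /andP[s0 _].
  rewrite Ubil0E; have [p1 p2 p3] := pos s0; have [q1 q2 q3] := gE s.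
  rewrite ?p1 ?p2 ?p3 ?q1 ?q2 ?q3.
  have := SC s; rewrite /x2 /x3 /h2 /h3 /e1 /e2.
  by move: (S s) (C s) (sin w) (cos w) => p q u v SCs; field: SCs.
- rewrite (@eq_prim1 (fun s => (- 2^-1 * b * a * c1 ^+ 2) * e1 s
     + (b ^+ 2 * w * c2) * e2 s)).
    rewrite comb /k /b.
    move: (sin w) (cos w) sw0 => u v u0; rewrite c11; field.
    by rewrite u0 w0.
  move=> s /andP[s0 _].
  rewrite Ubil1E; have [p1 p2 p3] := pos s0; have [q1 q2 q3] := gE s.
  rewrite ?p1 ?p2 ?p3 ?q1 ?q2 ?q3.
  have := SC s; rewrite /x1 /x3 /h1 /h3 /e1 /e2.
  by move: (S s) (C s) (sin w) (cos w) => p q u v SCs; field: SCs.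
(* What remains is the axial motion paired with the motion along [m], an area directed along [e3].
   Its antiderivative [T] takes equal values at [0] and [1]. *)
- pose T s := 2^-1 * (a * b * c1) * (s * S s + w^-1 * C s - sin w * s).
  pose t s := 2^-1 * (a * b * c1) * (2 * w * s * C s - S s - sin w).
  have ct : continuous t.
    by apply: cM => //; apply: cB => //; apply: cB => //; apply: cM => //; apply: cM.
  have dT s : is_derive s (1 : R) T (t s).
    have := is_derive1M (dcst (2^-1 * (a * b * c1)) s) (is_derive1B (is_derive1D
      (is_derive1M (did s) (dS s)) (is_derive1M (dcst w^-1 s) (dC s)))
      (is_derive1M (dcst (sin w) s) (did s))).
    move=> /is_derive_eq; apply; rewrite /t.
    by move: (S s) (C s) (sin w) => p q u; field.
  rewrite (@eq_prim1 t).
    by rewrite (prim_antiderivative ler01 ct dT) /T C0 C1 S1; ring.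
  move=> s /andP[s0 _].
  rewrite Ubil2E; have [p1 p2 p3] := pos s0; have [q1 q2 q3] := gE s.
  rewrite ?p1 ?p2 ?p3 ?q1 ?q2 ?q3.
  rewrite /t /x1 /x2 /h1 /h2.
  have c22 : c2 ^+ 2 = 1 - c1 ^+ 2 by rewrite -c12; ring.
  by move: (S s) (C s) (sin w) => p q u; field: c22.
Qed.

End Geodesic.

(** * Even functions of the Hermitian matrix [Uc tau] *)

Section FunctionalCalculus.
Variable R : realType.
Implicit Types (tau x : 'rV[R]_3) (f : R -> R).
Local Notation toC := (@real_complex_def R (Phant R)).
Local Notation MC := (map_mx toC).

(** The Cayley-Hamilton relation: the characteristic polynomial of [Umat tau] is
    [s^3 + |tau|^2 s]. *)
Lemma Umat_cube tau :
  Umat tau *m Umat tau *m Umat tau = - (norm3 tau ^+ 2 *: Umat tau).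
Proof.
rewrite sqr_norm3 dot3E; apply/matrixP; elim/ord3P; elim/ord3P;
  by rewrite !(mxE, sum3E) /=; ring.
Qed.

Lemma UcE tau : Uc tau = Complex 0 1 *: MC (Umat tau).
Proof.
apply/matrixP => i j; rewrite [LHS]mxE [RHS]mxE [X in _ * X]mxE.
by apply/eqP; rewrite eq_complex /= !mul0r !mul1r subrr add0r !eqxx.
Qed.

Lemma sqr_Uc tau : Uc tau *m Uc tau = - MC (Umat tau *m Umat tau).
Proof.
rewrite UcE -scalemxAl -scalemxAr scalerA -map_mxM.
rewrite (_ : _ * _ = -1) ?scaleN1r //.
by apply/eqP; rewrite eq_complex /= !mul0r !mul1r sub0r add0r oppr0 !eqxx.
Qed.

Lemma Uc_cube tau : Uc tau *m Uc tau *m Uc tau = toC (norm3 tau ^+ 2) *: Uc tau.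
Proof.
rewrite sqr_Uc UcE mulNmx -scalemxAr -map_mxM Umat_cube map_mxN map_mxZ.
by rewrite scalerN opprK !scalerA mulrC.
Qed.

(* The eigenvalues of [U(tau)] are among [0, |tau|, - |tau|], where an even [f]
   agrees with [s |-> f 0 + (f |tau| - f 0) / |tau|^2 * s^2]. *)
Lemma herm_fun_Uc_even f tau (F : 'M[R[i]]_3) :
  norm3 tau != 0 -> f (- norm3 tau) = f (norm3 tau) -> herm_fun f (Uc tau) F ->
  F = MC ((f 0)%:M - ((f (norm3 tau) - f 0) / norm3 tau ^+ 2) *: (Umat tau *m Umat tau)).
Proof.
set w := norm3 tau => w0 fev [Q [lam [QQ [HE FE]]]].
have QQ' := mulmx1C QQ.
pose D : 'M[R[i]]_3 := diag_mx (\row_i Complex (lam 0 i) 0).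
have HH : Uc tau *m Uc tau = Q *m (D *m D) *m cadj Q.
  by rewrite HE -/D !mulmxA -(mulmxA (Q *m D)) QQ' mulmx1.
have HHH : Uc tau *m Uc tau *m Uc tau = Q *m (D *m D *m D) *m cadj Q.
  by rewrite HH [in LHS]HE -/D !mulmxA -(mulmxA (Q *m D *m D)) QQ' mulmx1.
(* Conjugation by the unitary [Q] carries the cubic relation for [Uc tau] over to its diagonal form,
   hence to each eigenvalue. *)
have DDD : D *m D *m D = toC (w ^+ 2) *: D.
  have E : Q *m (D *m D *m D) *m cadj Q = Q *m (toC (w ^+ 2) *: D) *m cadj Q.
    by rewrite -HHH Uc_cube HE -scalemxAr -scalemxAl.
  have := congr1 (fun M => cadj Q *m M *m Q) E.
  by rewrite !mulmxA QQ' !mul1mx -!mulmxA QQ' !mulmx1.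
have lamE i : lam 0 i ^+ 3 = w ^+ 2 * lam 0 i.
  have := congr1 (fun M : 'M[R[i]]_3 => M i i) DDD.
  rewrite /D !mulmx_diag !mxE eqxx !mulr1n => /(congr1 (@complex.Re R)).
  rewrite /= !mulr0 !subr0 => E.
  by rewrite exprS expr2 mulrA -E.
set c := (f w - f 0) / w ^+ 2.
have fE i : f (lam 0 i) = f 0 + c * lam 0 i ^+ 2.
  have : lam 0 i * (lam 0 i - w) * (lam 0 i + w) = 0.
    by rewrite -[RHS](subrr (w ^+ 2 * lam 0 i)) -{1}lamE; ring.
  move/eqP; rewrite !mulf_eq0 subr_eq0 addr_eq0 -orbA => /or3P[] /eqP ->.
  - by rewrite expr0n /= mulr0 addr0.
  - by rewrite /c divfK ?expf_neq0 // addrC subrK.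
  - by rewrite sqrrN /c divfK ?expf_neq0 // addrC subrK.
have DE : diag_mx (\row_i Complex (f (lam 0 i)) 0) = (toC (f 0))%:M + toC c *: (D *m D).
  rewrite /D mulmx_diag; apply/matrixP => i j; rewrite !mxE.
  case: eqVneq => [->|_]; rewrite ?mulr1n ?mulr0n ?mulr0 ?addr0 //.
  by rewrite fE; apply/eqP; rewrite eq_complex /=; apply/andP; split; apply/eqP; ring.
rewrite FE DE mulmxDr mulmxDl -scalemxAr -scalemxAl -HH sqr_Uc.
rewrite scalar_mxC -mulmxA QQ mulmx1 map_mxB map_mxZ scalerN.
by rewrite map_scalar_mx.
Qed.

Lemma cnorm2_MC (A : 'M[R]_3) x : cnorm2 (MC A *m ccol x) = dot3 (x *m A^T) (x *m A^T).
Proof.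
have -> : MC A *m ccol x = MC (x *m A^T)^T.
  rewrite trmx_mul trmxK map_mxM; congr (_ *m _).
  by apply/matrixP => i j; rewrite !mxE ord1.
rewrite /cnorm2 /dot3; apply: eq_bigr => i _.
by rewrite !mxE /= expr0n addr0 expr2.
Qed.

End FunctionalCalculus.

Theorem theorem11p2 (R : realType) (a th1 th2 : R) :
  0 < a -> 0 < th2 -> norm3 (\row_(i < 3) [:: th1; th2; 0]`_i) < pi ->
  let x : 'rV[R]_3 := a *: evec 0 in
  let th : 'rV[R]_3 := \row_(i < 3) [:: th1; th2; 0]`_i in
  let nth := norm3 th in
  let t : 'rV[R]_3 :=
    (a ^+ 2 / 4 * th2) *:
      ((derive1 psi nth / nth * th2) *: th + (2 * psi nth) *: evec 1) in
  [/\ ccdist x t ^+ 2 = phi x t th,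
      phi x t th =
        norm3 x ^+ 2 * (1 + psi nth * th2 ^+ 2 + derive1 psi nth * nth * th2 ^+ 2),
      norm3 x ^+ 2 * (1 + psi nth * th2 ^+ 2 + derive1 psi nth * nth * th2 ^+ 2) =
        norm3 x ^+ 2 * (th1 ^+ 2 / nth ^+ 2 + (th2 / sin nth) ^+ 2)
    & forall F : 'M[R[i]]_3, herm_fun s_over_sin (Uc th) F ->
        norm3 x ^+ 2 * (th1 ^+ 2 / nth ^+ 2 + (th2 / sin nth) ^+ 2) =
        cnorm2 (F *m ccol x)].
Proof.
move=> a0 th20 wpi x th nth t.
have th00 : th 0 0 = th1 by rewrite mxE.
have th01 : th 0 1 = th2 by rewrite mxE.
have th02 : th 0 2 = 0 by rewrite mxE.
have w2 : nth ^+ 2 = th1 ^+ 2 + th2 ^+ 2.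
  by rewrite sqr_norm3 dot3E th00 th01 th02; ring.
have nth0 : 0 < nth.
  rewrite lt_def sqrtr_ge0 andbT -sqrf_eq0 w2 gt_eqF //.
  by rewrite ltr_wpDl ?sqr_ge0 // exprn_gt0.
have w0 : nth != 0 by rewrite gt_eqF.
have sw0 : sin nth != 0 by rewrite gt_eqF // sin_gt0_pi // nth0.
have x2 : norm3 x ^+ 2 = a ^+ 2.
  by rewrite sqr_norm3 dot3E !mxE /=; ring.
have psi'E := is_derive1_psi w0 sw0.
have psiE : psi nth = (1 - nth * cot nth) / nth ^+ 2 by rewrite /psi (negbTE w0).
have th1E : th1 ^+ 2 = nth ^+ 2 - th2 ^+ 2 by rewrite w2; ring.
have part2 : phi x t th = norm3 x ^+ 2 *
    (1 + psi nth * th2 ^+ 2 + derive1 psi nth * nth * th2 ^+ 2).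
  (* After this substitution the horizontal terms of [phi] add up to [a^2 (1 - psi th2^2)], and
     [4 t . th] contributes [a^2 (2 psi th2^2 + psi' |th| th2^2)]. *)
  have scotE : scot nth = 1 - psi nth * (th1 ^+ 2 + th2 ^+ 2).
    rewrite /scot (negbTE w0) psiE -w2; move: (cot nth) => c; field.
    exact: w0.
  rewrite /phi -/nth scotE x2 !dot3E !mxE /=.
  move: (derive1 psi nth) (psi nth) => p q.
  field: th1E.
  exact: w0.
(* The identity behind this is [psi(w) + w psi'(w) = 1 / sin(w)^2 - 1 / w^2], combined with
   [th1^2 + th2^2 = w^2]. *)
have part3 : norm3 x ^+ 2 * (1 + psi nth * th2 ^+ 2 + derive1 psi nth * nth * th2 ^+ 2) =
    norm3 x ^+ 2 * (th1 ^+ 2 / nth ^+ 2 + (th2 / sin nth) ^+ 2).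
  rewrite psi'E psiE th1E; congr (_ * _).
  by move: (cot nth) (sin nth) sw0 => c s s0; field; rewrite s0 w0.
split => //.
- rewrite part2 part3 x2.
  have c12 : (th1 / nth) ^+ 2 + (th2 / nth) ^+ 2 = 1.
    by rewrite !expr_div_n -mulrDl -w2 divff // sqrf_eq0.
  (* The helix has axis [th / |th|] and turns by the total angle [2 |th|]. *)
  pose h := geodesic_control nth (th1 / nth) (th2 / nth) a.
  have hadm : admissible_control h := geodesic_control_admissible _ _ _ _.
  have hx : hpos h 1 = x := hpos_geodesic a sw0 c12.
  have ht : hvert h 1 = t.
    have [e0 e1 e2] := hvert_geodesic a w0 sw0 c12.
    apply/rowP; elim/ord3P; rewrite (e0, e1, e2) !mxE /= psi'E psiE /cot.
    + move: (sin nth) (cos nth) sw0 => s c s0; field.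
      by rewrite s0 w0.
    + move: (sin nth) (cos nth) sw0 => s c s0; field.
      by rewrite s0 w0.
    + by rewrite !mulr0 addr0 mulr0.
  have hL : hlength h ^+ 2 = a ^+ 2 * (th1 ^+ 2 / nth ^+ 2 + (th2 / sin nth) ^+ 2).
    rewrite (hlength_geodesic a sw0 c12).
    by move: (sin nth) sw0 => s s0; field; rewrite s0 w0.
  rewrite -hL /ccdist; congr (_ ^+ 2).
  set A := (X in inf X).
  (* Every competitor has the same endpoint, where [phi x t th] equals the squared length of the
     helix. The helix is itself a competitor, so the infimum is attained by it. *)
  have Alb : lbound A (hlength h).
    move=> L [g [gadm [gx [gt ->]]]].
    rewrite -(ler_pXn2r (_ : 0 < 2)%N) // ?nnegrE ?hlength_ge0 //.
    rewrite hL -x2 -part3 -part2 -gx -gt.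
    by apply: phi_le_sqr_hlength => //; rewrite nth0.
  have Ah : A (hlength h) by exists h.
  apply/eqP; rewrite eq_le; apply/andP; split.
    by apply: ge_inf => //; exists (hlength h).
  by apply: lb_le_inf => //; exists (hlength h).
- move=> F /herm_fun_Uc_even -> //; last first.
    by rewrite /s_over_sin oppr_eq0 sinN invrN mulrNN.
  rewrite -/nth cnorm2_MC x2 /s_over_sin eqxx (negbTE w0) dot3E.
  (* Since [Umat th] squared is [th th^T - |th|^2], it sends [e1] to [(- th2^2, th1 th2, 0)]. *)
  have -> : x *m ((1%:M - ((nth / sin nth - 1) / nth ^+ 2) *: (Umat th *m Umat th))^T)
    = \row_i [:: a * (1 + (nth / sin nth - 1) / nth ^+ 2 * th2 ^+ 2);
        - a * ((nth / sin nth - 1) / nth ^+ 2 * (th1 * th2)); 0]`_i.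
    by apply/rowP; elim/ord3P; rewrite !(mxE, sum3E) /=; ring.
  rewrite !mxE /= th1E.
  move: (sin nth) sw0 => s s0.
  field: th1E.
  by rewrite s0 w0.
Qed.
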